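(* For any inventory placement $\boldsymbol c\in\mathbb Z_+^{nL}$ and any feasible solution $(\hat{\boldsymbol w},\hat{\boldsymbol y})$ of the fluid linear program given in the context, the expected total profit of the Inventory-Aware Simple Policy (Policy 1-IA) is equal to the expected total profit of the Simple Inventory-Agnostic Policy (Policy 1), where both policies start from $\boldsymbol c$ and use the same input $(\hat{\boldsymbol w},\hat{\boldsymbol y})$.
   Context: Setting. Products $\mathcal N=\{1,\dots,n\}$, customer types $\mathcal M=\{1,\dots,m\}$, warehouses $\mathcal L=\{1,\dots,L\}$, periods $\mathcal T=\{1,\dots,T\}$. In each period $t$ at most one customer arrives; a type-$j$ customer arrives with probability $\lambda_{jt}\ge0$ ($\sum_j\lambda_{jt}\le1$), independently across periods; $\tau_j=\sum_{t}\lambda_{jt}$. A type-$j$ customer offered $S\subseteq\mathcal N$ chooses product $i$ with probability $\phi_{ij}(S)$ (at most one product), independently across periods. Assumptions: $\phi_{kj}(S)=0$ if $k\notin S$; weak substitutability: $\phi_{ij}(S\cup\{k\})\le\phi_{ij}(S)$ for $i\in S$, $k\notin S$. Serving $i$ to type $j$ from warehouse $\ell$ gives profit $r_{ij}^\ell\in\mathbb R$. There is a virtual warehouse $L+1$ with infinite stock and $r_{ij}^{L+1}=0$; $\mathcal L_+=\mathcal L\cup\{L+1\}$. Initially there are $c_i^\ell$ units of product $i$ at warehouse $\ell\in\mathcal L$; each sale from a warehouse $\ell\in\mathcal L$ depletes its stock by one; $x_i^\ell(t)$ denotes the stock at the beginning of period $t$. Fluid linear program: over $w_j(S)\ge0$,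 $y_{ij}^\ell\ge0$ ($j\in\mathcal M$, $S\subseteq\mathcal N$, $i\in\mathcal N$, $\ell\in\mathcal L_+$), maximize $\sum_{i\in\mathcal N}\sum_{j\in\mathcal M}\sum_{\ell\in\mathcal L_+}r_{ij}^\ell y_{ij}^\ell$ subject to $\sum_{j}y_{ij}^\ell\le c_i^\ell$ for all $i\in\mathcal N,\ell\in\mathcal L$; $\sum_{S\subseteq\mathcal N}\phi_{ij}(S)w_j(S)=\sum_{\ell\in\mathcal L_+}y_{ij}^\ell$ for all $i,j$; $\sum_{S\subseteq\mathcal N}w_j(S)=\tau_j$ for all $j$. Given a feasible $(\hat{\boldsymbol w},\hat{\boldsymbol y})$, let $q_j(S)=\hat w_j(S)/\tau_j$ (a distribution over assortments) and $\rho_{ij}(\ell)=\hat y_{ij}^\ell/\sum_{\ell'\in\mathcal L_+}\hat y_{ij}^{\ell'}$ (a distribution over $\mathcal L_+$; arbitrary if the denominator is $0$). All sampling is done independently of the past. Policy 1: when a type-$j$ customer arrives, sample $\hat S\sim q_j$ and offer it. If she chooses product $i$, sample $\ell\sim\rho_{ij}$; if warehouse $\ell$ has positive stock of $i$, fulfill from $\ell$ (profit $r_{ij}^\ell$); otherwise sell from the virtual warehouse (profit $0$). Policy 1-IA: when a type-$j$ customer arrives in period $t$: (1) for each $i\in\mathcal N$ independently sample $\ell_i\sim\rho_{ij}$; (2) let $S_t=\{i\in\mathcal N:\ \ell_i\in\mathcal L,\ x_i^{\ell_i}(t)>0\}$; (3) offer an assortment $\tilde S\sim p'_{j,S_t}$,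 where $p'_{j,S_t}$ is a probability distribution over subsets of $S_t$ satisfying $\mathbb E_{S\sim p'_{j,S_t}}[\phi_{ij}(S)]=\mathbb E_{S\sim q_j}[\phi_{ij}(S)]$ for every $i\in S_t$ (such distributions exist under the assumptions on $\phi$); (4) if she chooses $i\in\tilde S$, fulfill from $\ell_i$ (profit $r_{ij}^{\ell_i}$). *)

(* Defs.v *)
From HB Require Import structures.
From mathcomp Require Import all_boot all_order all_algebra.
From mathcomp Require Import reals.

Set Implicit Arguments.
Unset Strict Implicit.
Unset Printing Implicit Defensive.

Import Order.TTheory GRing.Theory Num.Theory.
Local Open Scope ring_scope.

(* All randomness of the model is finite, so a law on a finite type is given by
   its mass function [A -> R]. *)

Definition is_pmf (R : realType) (A : finType) (p : A -> R) : Prop :=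
  (forall a, 0 <= p a) /\ \sum_a p a = 1.

Definition expect (R : realType) (A : finType) (p : A -> R) (f : A -> R) : R :=
  \sum_a p a * f a.

Definition pmf_ret (R : realType) (A : finType) (a : A) : A -> R :=
  fun b => (b == a)%:R.

(* Law of [b], where [a] is drawn from [p] and then [b] from [k a]. *)
Definition pmf_bind (R : realType) (A B : finType)
    (p : A -> R) (k : A -> B -> R) : B -> R :=
  fun b => \sum_a p a * k a b.

(* Conventions: products ['I_n], customer types ['I_m], periods ['I_T];
   warehouses [option 'I_L], where [None] is the virtual warehouse. Index order
   follows the notation: [phi i j S] is the probability that type [j] buys [i]
   when offered [S]; [r i j l], [y i j l], [rho i j l] and [c i l] are
   r_ij^l, y_ij^l, rho_ij(l) and c_i^l. *)

Definition arrival_model (R : realType) (m T : nat)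
    (lambda : 'I_m -> 'I_T -> R) : Prop :=
  (forall j t, 0 <= lambda j t) /\ (forall t, \sum_j lambda j t <= 1).

Definition expected_arrivals (R : realType) (m T : nat)
    (lambda : 'I_m -> 'I_T -> R) (j : 'I_m) : R :=
  \sum_t lambda j t.

Definition choice_model (R : realType) (n m : nat)
    (phi : 'I_n -> 'I_m -> {set 'I_n} -> R) : Prop :=
  [/\ forall i j S, 0 <= phi i j S,
      forall j S, \sum_i phi i j S <= 1
    & forall k j (S : {set 'I_n}), k \notin S -> phi k j S = 0].

Definition weakly_substitutable (R : realType) (n m : nat)
    (phi : 'I_n -> 'I_m -> {set 'I_n} -> R) : Prop :=
  forall i j (S : {set 'I_n}) k,
    i \in S -> k \notin S -> phi i j (k |: S) <= phi i j S.

Definition fluid_feasible (R : realType) (n m L T : nat)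
    (lambda : 'I_m -> 'I_T -> R)
    (phi : 'I_n -> 'I_m -> {set 'I_n} -> R)
    (c : 'I_n -> 'I_L -> nat)
    (w : 'I_m -> {set 'I_n} -> R)
    (y : 'I_n -> 'I_m -> option 'I_L -> R) : Prop :=
  [/\ forall j S, 0 <= w j S,
      forall i j l, 0 <= y i j l,
      forall i (l : 'I_L), \sum_j y i j (Some l) <= (c i l)%:R,
      forall i j, \sum_S phi i j S * w j S = \sum_l y i j l
    & forall j, \sum_S w j S = expected_arrivals lambda j].

(* When tau_j = 0 the quotient is meaningless (and type [j] never arrives);
   [q j] is then an arbitrary distribution. *)
Definition assortment_dist (R : realType) (n m T : nat)
    (lambda : 'I_m -> 'I_T -> R)
    (w q : 'I_m -> {set 'I_n} -> R) : Prop :=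
  forall j, is_pmf (q j) /\
    (expected_arrivals lambda j != 0 ->
     forall S, q j S = w j S / expected_arrivals lambda j).

Definition warehouse_dist (R : realType) (n m L : nat)
    (y rho : 'I_n -> 'I_m -> option 'I_L -> R) : Prop :=
  forall i j, is_pmf (rho i j) /\
    (\sum_l y i j l != 0 ->
     forall l, rho i j l = y i j l / \sum_l' y i j l').

(* [p j A] is the law p'_{j,A} on assortments contained in [A]. *)
Definition inventory_aware_dist (R : realType) (n m : nat)
    (phi : 'I_n -> 'I_m -> {set 'I_n} -> R)
    (q : 'I_m -> {set 'I_n} -> R)
    (p : 'I_m -> {set 'I_n} -> {set 'I_n} -> R) : Prop :=
  forall j (A : {set 'I_n}),
    [/\ is_pmf (p j A),
        forall S, p j A S != 0 -> S \subset A
      & forall i, i \in A -> expect (p j A) (phi i j) = expect (q j) (phi i j)].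

(* [Some (i, j, l)]: product [i] is sold to a type-[j] customer from [l];
   [None]: nobody arrives, or the customer buys nothing. *)
Definition event (n m L : nat) : finType :=
  option ('I_n * 'I_m * option 'I_L)%type.

Definition arrival_law (R : realType) (m T : nat)
    (lambda : 'I_m -> 'I_T -> R) (t : 'I_T) : option 'I_m -> R :=
  fun a => if a is Some j then lambda j t else 1 - \sum_j lambda j t.

Definition choice_law (R : realType) (n m : nat)
    (phi : 'I_n -> 'I_m -> {set 'I_n} -> R) (j : 'I_m) (S : {set 'I_n}) :
    option 'I_n -> R :=
  fun a => if a is Some i then phi i j S else 1 - \sum_i phi i j S.

Definition in_stock (n L : nat) (x : 'I_n -> 'I_L -> nat)
    (i : 'I_n) (l : option 'I_L) : bool :=
  if l is Some l' then (0 < x i l')%N else false.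

(* A policy is represented by the conditional law of the event of period [t]
   given the stock [x] at the beginning of that period. *)
Definition policy (R : realType) (n m L T : nat) : Type :=
  ('I_n -> 'I_L -> nat) -> 'I_T -> event n m L -> R.

Definition inventory_agnostic_policy (R : realType) (n m L T : nat)
    (lambda : 'I_m -> 'I_T -> R)
    (phi : 'I_n -> 'I_m -> {set 'I_n} -> R)
    (q : 'I_m -> {set 'I_n} -> R)
    (rho : 'I_n -> 'I_m -> option 'I_L -> R) : policy R n m L T :=
  fun x t =>
    pmf_bind (arrival_law lambda t) (fun a =>
    if a is Some j then
      pmf_bind (q j) (fun S =>
      pmf_bind (choice_law phi j S) (fun b =>
      if b is Some i then
        pmf_bind (rho i j) (fun l =>
        pmf_ret R
          (Some (i, j, if in_stock x i l then l else None) : event n m L))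
      else pmf_ret R None))
    else pmf_ret R None).

Definition inventory_aware_policy (R : realType) (n m L T : nat)
    (lambda : 'I_m -> 'I_T -> R)
    (phi : 'I_n -> 'I_m -> {set 'I_n} -> R)
    (rho : 'I_n -> 'I_m -> option 'I_L -> R)
    (p : 'I_m -> {set 'I_n} -> {set 'I_n} -> R) : policy R n m L T :=
  fun x t =>
    pmf_bind (arrival_law lambda t) (fun a =>
    if a is Some j then
      pmf_bind (fun ls : {ffun 'I_n -> option 'I_L} => \prod_i rho i j (ls i))
        (fun ls =>
      pmf_bind (p j [set i | in_stock x i (ls i)]) (fun S =>
      pmf_bind (choice_law phi j S) (fun b =>
      if b is Some i then pmf_ret R (Some (i, j, ls i) : event n m L)
      else pmf_ret R None)))
    else pmf_ret R None).

Definition is_sale_from (n m L : nat) (i : 'I_n) (l : 'I_L)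
    (e : event n m L) : bool :=
  if e is Some (i', _, l') then (i' == i) && (l' == Some l) else false.

(* x_i^l(t) along the sequence of events [h]. The subtraction is truncated, but
   both policies sell from a warehouse only when its stock is positive, so no
   truncation occurs on sequences of positive probability. *)
Definition stock_at (n m L T : nat) (c : 'I_n -> 'I_L -> nat)
    (h : {ffun 'I_T -> event n m L}) (t : 'I_T) : 'I_n -> 'I_L -> nat :=
  fun i l => (c i l - #|[set s : 'I_T | (s < t)%N && is_sale_from i l (h s)]|)%N.

(* Law of the whole sequence of events, by the chain rule. *)
Definition path_law (R : realType) (n m L T : nat) (pol : policy R n m L T)
    (c : 'I_n -> 'I_L -> nat) : {ffun 'I_T -> event n m L} -> R :=
  fun h => \prod_t pol (stock_at c h t) t (h t).

Definition event_profit (R : realType) (n m L : nat)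
    (r : 'I_n -> 'I_m -> option 'I_L -> R) (e : event n m L) : R :=
  if e is Some (i, j, l) then r i j l else 0.

Definition expected_total_profit (R : realType) (n m L T : nat)
    (r : 'I_n -> 'I_m -> option 'I_L -> R) (pol : policy R n m L T)
    (c : 'I_n -> 'I_L -> nat) : R :=
  expect (path_law pol c) (fun h => \sum_t event_profit r (h t)).

(* Main.v *)
(* In any state, a sale of product i to type j from a real warehouse l has the
   same probability under both policies: it is
   lambda_jt * E_{S ~ q_j}[phi_ij(S)] * rho_ij(l) if l has stock of i, and 0
   otherwise. Policy 1-IA gets there because, once l_i = l is in stock, the law
   p' reproduces the purchase probability of i whatever the other samples are.
   The policies differ only in how they split the remaining mass between virtual
   sales and no sale, which affects neither the profit nor the stock; after
   merging these two outcomes the laws of the whole history coincide. *)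

Require Import Defs.
From HB Require Import structures.
From mathcomp Require Import all_boot all_order all_algebra.
From mathcomp Require Import reals.
From mathcomp Require boolp.

Set Implicit Arguments.
Unset Strict Implicit.
Unset Printing Implicit Defensive.

Import Order.TTheory GRing.Theory Num.Theory.
Local Open Scope ring_scope.

Section FiniteLaws.

Variable R : realType.

Definition pmf_push (A B : finType) (k : A -> B) (p : A -> R) : B -> R :=
  fun b => \sum_(a | k a == b) p a.

Lemma expect_push (A B : finType) (k : A -> B) (p : A -> R) (f : B -> R) :
  expect (pmf_push k p) f = expect p (f \o k).
Proof.
rewrite /expect [RHS](partition_big k predT) //=.
apply: eq_bigr => b _; rewrite /pmf_push mulr_suml.
by apply: eq_bigr => a /eqP ->.
Qed.

Lemma sum_pmf_ret (A : finType) (a : A) : \sum_b pmf_ret R a b = 1.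
Proof.
rewrite (bigD1 a) //= /pmf_ret eqxx big1 ?addr0 // => b.
by case: eqP.
Qed.

Lemma sum_pmf_bind (A B : finType) (p : A -> R) (k : A -> B -> R) :
  (forall a, \sum_b k a b = 1) -> \sum_b pmf_bind p k b = \sum_a p a.
Proof.
move=> k1; rewrite exchange_big /=; apply: eq_bigr => a _.
by rewrite -mulr_sumr k1 mulr1.
Qed.

(** Peels off one stage of a policy: an event names the customer type, the product and the
    warehouse, so only one draw at that stage can lead to it. *)
Lemma pmf_bind_single (A B : finType) (p : A -> R) (k : A -> B -> R) a b :
  (forall a', a' != a -> k a' b = 0) -> pmf_bind p k b = p a * k a b.
Proof.
move=> k0; rewrite /pmf_bind (bigD1 a) //= big1 ?addr0 // => a' /k0 ->.
exact: mulr0.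
Qed.

Lemma sum_option (A : finType) (p : option A -> R) :
  \sum_a p a = p None + \sum_a p (Some a).
Proof.
rewrite (bigD1 None) //=; congr (_ + _).
rewrite (reindex_omap Some id) /=; last by case.
by apply: eq_bigl => a; rewrite eqxx.
Qed.

Lemma sum_prod_pmf (I A : finType) (p : I -> A -> R) :
  (forall i, \sum_a p i a = 1) -> \sum_(f : {ffun I -> A}) \prod_i p i (f i) = 1.
Proof. by move=> p1; rewrite -bigA_distr_bigA big1. Qed.

(** Under a product law, a function of one coordinate sees only the marginal of that coordinate: the
    other factors sum to one. *)
Lemma sum_prod_pmf_marginal (I A : finType) (p : I -> A -> R) i (g : A -> R) :
  (forall i, \sum_a p i a = 1) ->
  \sum_(f : {ffun I -> A}) (\prod_i' p i' (f i')) * g (f i) = \sum_a p i a * g a.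
Proof.
move=> p1.
(* Absorbing [g] into factor [i] keeps the summand a product over coordinates, so that sum and
   product can be exchanged. *)
pose p' i' a := p i' a * (if i' == i then g a else 1).
transitivity (\sum_(f : {ffun I -> A}) \prod_i' p' i' (f i')).
  apply: eq_bigr => f _; rewrite big_split /=; congr (_ * _).
  by rewrite -big_mkcond (big_pred1 i).
rewrite -bigA_distr_bigA (bigD1 i) //= [X in _ * X]big1 ?mulr1; last first.
  by move=> i' /negPf ne; under eq_bigr do rewrite /p' ne mulr1.
by apply: eq_bigr => a _; rewrite /p' eqxx.
Qed.

End FiniteLaws.

Section Recorded.

Variables (R : realType) (n m L T : nat).

(* The virtual warehouse brings no profit and holds no tracked stock, so selling
   from it is identified with not selling. *)
Definition recorded (e : event n m L) : event n m L :=
  if e is Some (_, _, None) then None else e.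

Definition recorded_path (h : {ffun 'I_T -> event n m L}) :
    {ffun 'I_T -> event n m L} := [ffun t => recorded (h t)].

Lemma is_sale_from_recorded i (l : 'I_L) (e : event n m L) :
  is_sale_from i l (recorded e) = is_sale_from i l e.
Proof. by case: e => [[[i' j] [l'|]]|] //=; rewrite andbF. Qed.

Lemma event_profit_recorded (r : 'I_n -> 'I_m -> option 'I_L -> R) :
  (forall i j, r i j None = 0) ->
  forall e, event_profit r (recorded e) = event_profit r e.
Proof. by move=> r0 [[[i j] [l|]]|] //=. Qed.

Lemma stock_at_recorded (c : 'I_n -> 'I_L -> nat) h (t : 'I_T) :
  stock_at c (recorded_path h) t = stock_at c h t.
Proof.
rewrite /stock_at; apply: boolp.funext => i; apply: boolp.funext => l.
congr (_ - _)%N; apply: eq_card => s.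
by rewrite !inE ffunE is_sale_from_recorded.
Qed.

(** The stock depends on a path only through its recorded version, so each factor of the chain rule
    uses the same state throughout a fibre of [recorded_path]. That fibre is a product of fibres of
    [recorded], hence the sum of products factors period by period. *)
Lemma path_law_recorded (pol : policy R n m L T) c :
  pmf_push recorded_path (path_law pol c) =1
  path_law (fun x t => pmf_push recorded (pol x t)) c.
Proof.
move=> g; rewrite /path_law /pmf_push bigA_distr_big_dep /=.
apply: eq_big => [h | h /eqP <-].
  apply/eqP/familyP => [<- t | gh]; first by rewrite !unfold_in ffunE.
  by apply/ffunP => t; rewrite ffunE; apply/eqP/gh.
by apply: eq_bigr => t _; rewrite stock_at_recorded.
Qed.

(** Reduces the comparison over the whole horizon to a single period in an arbitrary state: the
    total profit is a function of the recorded path alone. *)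
Lemma expected_total_profit_recorded r (pol1 pol2 : policy R n m L T) c :
  (forall i j, r i j None = 0) ->
  (forall x t, pmf_push recorded (pol1 x t) =1 pmf_push recorded (pol2 x t)) ->
  expected_total_profit r pol1 c = expected_total_profit r pol2 c.
Proof.
move=> r0 pol12.
have profitE pol : expected_total_profit r pol c =
    expect (pmf_push recorded_path (path_law pol c))
           (fun h => \sum_t event_profit r (h t)).
  rewrite expect_push; apply: eq_bigr => h _; congr (_ * _).
  by apply: eq_bigr => t _; rewrite ffunE event_profit_recorded.
rewrite !profitE; apply: eq_bigr => g _; rewrite !path_law_recorded.
by congr (_ * _); apply: eq_bigr => t _; apply: pol12.
Qed.

(* Mass conservation determines the probability of recording no sale. *)
Lemma eq_push_recorded (p1 p2 : event n m L -> R) :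
  \sum_e p1 e = \sum_e p2 e ->
  (forall i j l, p1 (Some (i, j, Some l)) = p2 (Some (i, j, Some l))) ->
  pmf_push recorded p1 =1 pmf_push recorded p2.
Proof.
move=> mass12 sale12.
have eq_sale e : recorded e != None -> p1 e = p2 e.
  by case: e => [[[i j] [l|]]|].
case=> [e|]; first by apply: eq_bigr => e' /eqP e'E; rewrite eq_sale ?e'E.
move: mass12.
rewrite (bigID (fun e => recorded e == None)) /=.
rewrite [RHS](bigID (fun e => recorded e == None)) /=.
by rewrite [X in _ + X = _](eq_bigr p2) // => /addIr.
Qed.

End Recorded.

Section Policies.

Variables (R : realType) (n m L T : nat).
Variables (lambda : 'I_m -> 'I_T -> R) (phi : 'I_n -> 'I_m -> {set 'I_n} -> R).
Variables (q : 'I_m -> {set 'I_n} -> R).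
Variables (rho : 'I_n -> 'I_m -> option 'I_L -> R).
Variables (p : 'I_m -> {set 'I_n} -> {set 'I_n} -> R).
Hypothesis rho1 : forall i j, \sum_l rho i j l = 1.

Lemma sum_arrival_law (t : 'I_T) : \sum_a arrival_law lambda t a = 1.
Proof. by rewrite sum_option /= subrK. Qed.

Lemma sum_choice_law j S : \sum_b choice_law phi j S b = 1.
Proof. by rewrite sum_option /= subrK. Qed.

Lemma sum_inventory_agnostic_policy x t :
  (forall j, \sum_S q j S = 1) ->
  \sum_e inventory_agnostic_policy lambda phi q rho x t e = 1.
Proof.
move=> q1; rewrite sum_pmf_bind ?sum_arrival_law // => -[j|]; last first.
  exact: sum_pmf_ret.
rewrite sum_pmf_bind ?q1 // => S.
rewrite sum_pmf_bind ?sum_choice_law // => -[i|]; last exact: sum_pmf_ret.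
by rewrite sum_pmf_bind ?rho1 // => l; apply: sum_pmf_ret.
Qed.

Lemma sum_inventory_aware_policy x t :
  (forall j A, \sum_S p j A S = 1) ->
  \sum_e inventory_aware_policy lambda phi rho p x t e = 1.
Proof.
move=> p1; rewrite sum_pmf_bind ?sum_arrival_law // => -[j|]; last first.
  exact: sum_pmf_ret.
rewrite sum_pmf_bind; first by rewrite (sum_prod_pmf (p := rho^~ j)).
move=> ls; rewrite sum_pmf_bind ?p1 // => S.
by rewrite sum_pmf_bind ?sum_choice_law // => -[i|]; apply: sum_pmf_ret.
Qed.

Lemma inventory_agnostic_sale x t i j (l : 'I_L) :
  inventory_agnostic_policy lambda phi q rho x t (Some (i, j, Some l)) =
  lambda j t * (expect (q j) (phi i j) * (rho i j (Some l) * (0 < x i l)%:R)).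
Proof.
rewrite /inventory_agnostic_policy (pmf_bind_single _ (a := Some j)) /=; last first.
  move=> [j'|] // nej; rewrite /pmf_bind big1 // => S _.
  rewrite big1 ?mulr0 // => -[i'|] _; last by rewrite mulr0.
  rewrite big1 ?mulr0 // => l' _; rewrite /pmf_ret.
  case: eqP => [[_ jE _]|]; last by rewrite mulr0.
  by rewrite jE eqxx in nej.
congr (_ * _); rewrite /expect mulr_suml; apply: eq_bigr => S _; rewrite -mulrA.
congr (_ * _); rewrite (pmf_bind_single _ (a := Some i)) /=; last first.
  move=> [i'|] // nei; rewrite /pmf_bind big1 // => l' _; rewrite /pmf_ret.
  case: eqP => [[iE _]|]; last by rewrite mulr0.
  by rewrite iE eqxx in nei.
congr (_ * _); rewrite (pmf_bind_single _ (a := Some l)) /=; last first.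
  (* A draw [l'] other than [l] is either kept or redirected to the virtual warehouse; neither gives
     a sale from [l]. *)
  move=> l' nel; rewrite /pmf_ret; case: ifP => _; last by case: eqP => // -[].
  case: eqP => // -[lE]; by rewrite lE eqxx in nel.
rewrite /pmf_ret.
by case: (0 < x i l)%N; case: eqP.
Qed.

Lemma inventory_aware_sale x t i j (l : 'I_L) :
  (forall k j (S : {set 'I_n}), k \notin S -> phi k j S = 0) ->
  inventory_aware_dist phi q p ->
  inventory_aware_policy lambda phi rho p x t (Some (i, j, Some l)) =
  lambda j t * (expect (q j) (phi i j) * (rho i j (Some l) * (0 < x i l)%:R)).
Proof.
move=> phi0 pP.
rewrite /inventory_aware_policy (pmf_bind_single _ (a := Some j)) /=; last first.
  move=> [j'|] // nej; rewrite /pmf_bind big1 // => ls _.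
  rewrite [X in _ * X]big1 ?mulr0 // => S _.
  rewrite big1 ?mulr0 // => -[i'|] _.
    rewrite /pmf_ret; case: eqP => [[_ jE _]|]; last by rewrite mulr0.
    by rewrite jE eqxx in nej.
  by rewrite mulr0.
congr (_ * _).
(* [g l'] is the probability that [i] is sold from [l] to an arrived type-[j] customer, given that
   the sample for [i] is [l']. It ignores the other samples, so only the marginal [rho i j]
   remains. *)
pose g l' : R := expect (q j) (phi i j) * ((l' == Some l) && (0 < x i l)%N)%:R.
transitivity (\sum_(ls : {ffun 'I_n -> option 'I_L})
    (\prod_i' rho i' j (ls i')) * g (ls i)); last first.
  rewrite (sum_prod_pmf_marginal i g (fun i => rho1 i j)) (bigD1 (Some l)) //=.
  rewrite big1 ?addr0 /g ?eqxx /=; first by rewrite mulrCA.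
  by move=> l' /negPf ->; rewrite /= !mulr0.
apply: eq_bigr => ls _; congr (_ * _).
have [_ p_sub p_phi] := pP j [set i | in_stock x i (ls i)].
transitivity (expect (p j [set i | in_stock x i (ls i)]) (phi i j)
              * (ls i == Some l)%:R).
  rewrite /expect mulr_suml; apply: eq_bigr => S _; rewrite -mulrA.
  congr (_ * _); rewrite (pmf_bind_single _ (a := Some i)) /=; last first.
    move=> [i'|] // nei; rewrite /pmf_ret.
    by case: eqP => [[iE _]|] //; rewrite iE eqxx in nei.
  congr (_ * _); rewrite /pmf_ret; congr (_%:R); congr nat_of_bool.
  by apply/eqP/eqP => [[->]|->].
rewrite /g; case: eqP => [lsi|]; last by rewrite !mulr0.
have [x0|x0] /= := boolP (0 < x i l)%N.
  by rewrite p_phi // inE lsi.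
(* Without stock at [l], product [i] lies outside the set of available products, hence outside every
   assortment [S] of nonzero mass, and is never chosen. *)
rewrite mulr1 mulr0 /expect big1 // => S _.
have [->|/p_sub/subsetP sub] := eqVneq (p j [set i | in_stock x i (ls i)] S) 0.
  by rewrite mul0r.
rewrite phi0 ?mulr0 //; apply/negP => /sub.
by rewrite inE lsi /= (negPf x0).
Qed.

End Policies.

Theorem theorem6p2 (R : realType) (n m L T : nat)
    (lambda : 'I_m -> 'I_T -> R)
    (phi : 'I_n -> 'I_m -> {set 'I_n} -> R)
    (r : 'I_n -> 'I_m -> option 'I_L -> R)
    (c : 'I_n -> 'I_L -> nat)
    (w : 'I_m -> {set 'I_n} -> R)
    (y : 'I_n -> 'I_m -> option 'I_L -> R)
    (q : 'I_m -> {set 'I_n} -> R)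
    (rho : 'I_n -> 'I_m -> option 'I_L -> R)
    (p : 'I_m -> {set 'I_n} -> {set 'I_n} -> R)
    (Hlambda : arrival_model lambda)
    (Hphi : choice_model phi)
    (Hsubst : weakly_substitutable phi)
    (Hr : forall i j, r i j None = 0)
    (Hwy : fluid_feasible lambda phi c w y)
    (Hq : assortment_dist lambda w q)
    (Hrho : warehouse_dist y rho)
    (Hp : inventory_aware_dist phi q p) :
  expected_total_profit r (inventory_aware_policy lambda phi rho p) c =
  expected_total_profit r (inventory_agnostic_policy lambda phi q rho) c.
Proof.
have [_ _ phi0] := Hphi.
have rho1 i j : \sum_l rho i j l = 1 by have [[]] := Hrho i j.
have q1 j : \sum_S q j S = 1 by have [[]] := Hq j.
have p1 j A : \sum_S p j A S = 1 by have [[]] := Hp j A.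
apply: expected_total_profit_recorded => // x t; apply: eq_push_recorded.
  by rewrite sum_inventory_aware_policy ?sum_inventory_agnostic_policy.
move=> i j l.
by rewrite (inventory_aware_sale _ rho1 _ _ _ _ _ phi0 Hp) inventory_agnostic_sale.
Qed.
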